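(* Let $\pi$ and $\varpi$ be non-zero polynomial divided difference operators in the variables $(x,y)$ and $(y,z)$ respectively, for which the cubic braid relation $\pi\varpi\pi=\varpi\pi\varpi$ holds, and assume that $Q_0$ and $\widetilde Q_0$ do not vanish. Then the polynomials $T$ and $\widetilde T$ coincide, and $Q_0$ and $\widetilde Q_0$ are almost equal.
   Context: $K$ is a field of arbitrary characteristic over which all polynomials are defined; possible extra parameters are regarded as elements of $K$. The operators act on functions $f$ of $x,y,z$ (and possibly other variables), concretely on polynomials over $K$. The operator $s$ interchanges $x$ and $y$, and $\sigma$ interchanges $y$ and $z$; $\partial f=\frac{f-sf}{x-y}$ and $\delta f=\frac{f-\sigma f}{y-z}$. A polynomial divided difference operator in the variables $(x,y)$ is an operator $\pi f=\partial(P(x,y)f)+Q(x,y)\partial f+R(x,y)f+S(x,y)sf$ with two-variable polynomials $P,Q,R,S$; one in the variables $(y,z)$ is $\varpi f=\delta(\widetilde P(y,z)f)+\widetilde Q(y,z)\delta f+\widetilde R(y,z)f+\widetilde S(y,z)\sigma f$. The polynomials $Q_0(u,v)=P(v,u)+Q(u,v)-(u-v)S(u,v)$ and $T(u,v)=P(u,v)+(u-v)R(u,v)+Q(u,v)$, and similarly $\widetilde Q_0$ and $\widetilde T$ defined from $\widetilde P,\widetilde Q,\widetilde R,\widetilde S$, depend only on the operators, not on the presentations. They are compared as polynomials in the same two variables $u,v$. Two non-zero polynomials $A$ and $\widetilde A$ in two variables $u,v$ are almost equal if there exist a polynomial $\widehat A$ in two variables and univariate polynomials $q_l,q_r,\widetilde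 q_l,\widetilde q_r$ satisfying $q_l q_r=\widetilde q_l\widetilde q_r$ (an equality of univariate polynomials) such that $A(u,v)=q_l(u)q_r(v)\widehat A(u,v)$ and $\widetilde A(u,v)=\widetilde q_l(u)\widetilde q_r(v)\widehat A(u,v)$. *)

(* Defs.v *)
From mathcomp Require Import all_boot all_order all_fingroup all_algebra.
From mathcomp Require Import mpoly.

Set Implicit Arguments.
Unset Strict Implicit.
Unset Printing Implicit Defensive.

Import GRing.Theory.
Local Open Scope ring_scope.

Section DividedDifference.
Variables (K : fieldType) (n : nat).
Implicit Types (i j : 'I_n) (f g : {mpoly K[n]}).

Definition swap i j f : {mpoly K[n]} := msym (tperm i j) f.

Lemma swapX i j k : swap i j 'X_k = 'X_(tperm i j k).
Proof. by rewrite /swap /msym mmapX mmap1U. Qed.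

Lemma divdiff_subproof i j f : exists g, f - swap i j f == ('X_i - 'X_j) * g.
Proof.
pose D h := exists g, h - swap i j h == ('X_i - 'X_j) * g.
have DM h1 h2 : D h1 -> D h2 -> D (h1 * h2).
  move=> [g1 /eqP e1] [g2 /eqP e2]; exists (g1 * h2 + swap i j h1 * g2).
  rewrite mulrDr mulrA -e1 mulrCA -e2 /swap msymM mulrBl mulrBr.
  by rewrite addrA subrK.
have DX k : D 'X_k.
  rewrite /D swapX; case: tpermP => [->|->|_ _].
  - by exists 1; rewrite mulr1.
  - by exists (- 1); rewrite mulrN1 opprB.
  - by exists 0; rewrite subrr mulr0.
have D1 : D 1 by exists 0; rewrite /swap rmorph1 subrr mulr0.
elim/mpolyind: f => [|c m p _ _ [gp /eqP ep]].
  by exists 0; rewrite /swap raddf0 subrr mulr0.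
have [gm /eqP em] : D 'X_[m].
  rewrite mpolyXE_id; apply: (big_ind D) => // k _.
  by elim: (m k) => [|e IHe]; rewrite ?expr0 // exprS; apply: DM.
exists (c *: gm + gp).
rewrite mulrDr -scalerAr -em -ep /swap msymD msymZ scalerBr.
by rewrite opprD addrACA.
Qed.

(* The exact quotient (f - s f) / (X_i - X_j), where s swaps X_i and X_j;
   it is uniquely determined, by divdiffP, as soon as i != j. *)
Definition divdiff i j f : {mpoly K[n]} := xchoose (divdiff_subproof i j f).

Lemma divdiffP i j f : f - swap i j f = ('X_i - 'X_j) * divdiff i j f.
Proof. exact/eqP/(xchooseP (divdiff_subproof i j f)). Qed.

End DividedDifference.

Section Operators.
Variable K : fieldType.

Definition subst2 n (A : {mpoly K[2]}) (a b : {mpoly K[n]}) : {mpoly K[n]} :=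
  A \mPo [tuple a; b].

Definition subst1 n (q : {poly K}) (a : {mpoly K[n]}) : {mpoly K[n]} :=
  (map_poly (@mpolyC n K) q).[a].

(* A presentation (P, Q, R, S) of a polynomial divided difference operator.
   The operator itself is the map pdd_act i j w on polynomials, where X_i, X_j
   are the two variables in which w is taken. *)
Record pdd := Pdd {
  pdd_P : {mpoly K[2]};
  pdd_Q : {mpoly K[2]};
  pdd_R : {mpoly K[2]};
  pdd_S : {mpoly K[2]}
}.

Definition pdd_act n (i j : 'I_n) (w : pdd) (f : {mpoly K[n]}) : {mpoly K[n]} :=
  divdiff i j (subst2 (pdd_P w) 'X_i 'X_j * f)
  + subst2 (pdd_Q w) 'X_i 'X_j * divdiff i j f
  + subst2 (pdd_R w) 'X_i 'X_j * f
  + subst2 (pdd_S w) 'X_i 'X_j * swap i j f.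

Definition var_u : {mpoly K[2]} := 'X_0.
Definition var_v : {mpoly K[2]} := 'X_1.

Definition pdd_Q0 (w : pdd) : {mpoly K[2]} :=
  subst2 (pdd_P w) var_v var_u + pdd_Q w - (var_u - var_v) * pdd_S w.

Definition pdd_T (w : pdd) : {mpoly K[2]} :=
  pdd_P w + (var_u - var_v) * pdd_R w + pdd_Q w.

Definition almost_equal (A A' : {mpoly K[2]}) : Prop :=
  [/\ A != 0, A' != 0 &
    exists (B : {mpoly K[2]}) (ql qr ql' qr' : {poly K}),
      [/\ ql * qr = ql' * qr',
          A = subst1 ql var_u * subst1 qr var_v * B &
          A' = subst1 ql' var_u * subst1 qr' var_v * B]].

End Operators.

(* Main.v *)
Require Import Defs.
From mathcomp Require Import all_boot all_order all_fingroup all_algebra.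
From mathcomp Require Import mpoly.
From mathcomp Require Import ring.

Set Implicit Arguments.
Unset Strict Implicit.
Unset Printing Implicit Defensive.

Import GRing.Theory.
Local Open Scope ring_scope.

(** One has (x - y) pi f = T(x, y) f - Q0(x, y) s f, and likewise for varpi, so
both sides of the braid relation are combinations of the six permutations of
x, y, z, which are linearly independent over the polynomials. Comparing the
coefficients of sigma s gives T = T~, and comparing those of s sigma s gives
    Q0(x, y) Q0~(x, z) Q0(y, z) = Q0~(y, z) Q0(x, z) Q0~(x, y).
Taking leading coefficients in y, which unlike specializing y works over a
finite field, yields univariate a, a', b, b' with
    a(u) a'(v) Q0~(u, v) = b(u) b'(v) Q0(u, v);
putting this back into the identity gives a a' = b b'. After division by
gcd(a, b) this reads b(u) a(v) Q0 = a(u) b(v) Q0~ with a and b coprime, and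
hence Q0 = a(u) b(v) C and Q0~ = b(u) a(v) C. *)

(** * Divisibility in K[u][v] and the functional equation linking Q0 and Q0~ *)

Section Bivariate.
Variable K : fieldType.
Implicit Types (a b : {poly K}) (A B C : {poly {poly K}}).

(** Non-zero polynomials in u alone and in v alone share only constant factors. This form of Gauss's
    lemma splits off factors one variable at a time. *)
Lemma polyC_dvd_map_mul a b A B :
  b != 0 -> a%:P * B = b^:P * A -> exists C, A = a%:P * C.
Proof.
move=> b0 e; have lb : lead_coef b^:P \is a GRing.unit.
  by rewrite lead_coef_map poly_unitE size_polyC coefC eqxx unitfE lead_coef_eq0 b0.
have bP0 : b^:P != 0 by rewrite map_polyC_eq0.
(* Seen in K[u][v], b(v) has a constant leading coefficient: divide B by it. *)
have eB := Pdiv.IdomainUnit.divp_eq lb B.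
exists (B %/ b^:P); apply/eqP; rewrite -subr_eq0; apply/negPn/negP=> D0.
have : b^:P * (A - a%:P * (B %/ b^:P)) = a%:P * (B %% b^:P).
  by rewrite mulrBr -e [in a%:P * B]eB; ring.
(* The right side has smaller v-degree than b(v), while a non-zero cofactor on the left would give
   at least that degree. *)
move=> e1; have es := congr1 (size \o polyseq) e1.
rewrite /= size_mul // [in RHS]mul_polyC in es.
have: (size (a *: (B %% b^:P)) < size b^:P)%N.
  by rewrite (leq_ltn_trans (size_scale_leq _ _)) // ltn_modp.
by rewrite -es ltnNge -subn1 -addnBA ?leq_addr // lt0n size_poly_eq0.
Qed.

Lemma coprime_cross_factor a b A B : coprimep a b -> a != 0 -> b != 0 ->
  A * b%:P * a^:P = B * a%:P * b^:P -> exists C, A = a%:P * b^:P * C.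
Proof.
move=> /Bezout_eq1_coprimepP [[s t] /= est] a0 b0 e.
have est1 : s%:P * a%:P + t%:P * b%:P = 1 :> {poly {poly K}}.
  by rewrite -!polyCM -polyCD est.
have [A1 eA] : exists A1, A = a%:P * A1.
  (* By [e] and s a + t b = 1, a(u) times this witness is a(v) A. *)
  apply: (@polyC_dvd_map_mul a a A (B * b^:P * t%:P + A * a^:P * s%:P)) => //.
  transitivity (B * a%:P * b^:P * t%:P + A * a^:P * s%:P * a%:P); first by ring.
  by rewrite -e -[a^:P * A]mulr1 -est1; ring.
have e1 : A1 * b%:P * a^:P = B * b^:P.
  have aP0 : a%:P != 0 :> {poly {poly K}} by rewrite polyC_eq0.
  apply: (mulfI aP0); transitivity (A * b%:P * a^:P); first by rewrite eA; ring.
  by rewrite e; ring.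
(* Exchanging u and v turns divisibility of [A1] by b(v) into divisibility by b(u), so the same
   argument applies. *)
have {}e1 := congr1 (@swapXY K) e1.
rewrite !rmorphM /= !swapXY_polyC !swapXY_map_polyC in e1.
have [C eC] : exists C, swapXY A1 = b%:P * C.
  apply: (@polyC_dvd_map_mul b b _ (swapXY B * s%:P + swapXY A1 * b^:P * t%:P)) => //.
  transitivity (swapXY B * b%:P * s%:P + swapXY A1 * b^:P * t%:P * b%:P); first by ring.
  by rewrite -e1 -[b^:P * _]mulr1 -est1; ring.
exists (swapXY C); rewrite eA -[A1]swapXYK eC rmorphM /= swapXY_polyC; ring.
Qed.

(* Bivariate polynomials in u, v are in K[u][v], with [u = 'Y] and [v = 'X].
   With [x = 'X%:P%:P], [z = 'X%:P] and [y = 'X] in {poly {poly {poly K}}}, the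
   polynomials [A^:P], [A%:P] and [shiftXY A] are A(x, y), A(x, z) and A(y, z). *)
Definition shiftXY A : {poly {poly {poly K}}} :=
  map_poly (map_poly polyC) (swapXY A).

Lemma shiftXYM : {morph shiftXY : A B / A * B}.
Proof. by move=> A B; rewrite /shiftXY !rmorphM. Qed.

Lemma shiftXY_polyC a : shiftXY a%:P = a^:P^:P.
Proof.
rewrite /shiftXY swapXY_polyC -!map_poly_comp.
by apply: eq_map_poly => c /=; rewrite map_polyC.
Qed.

Lemma shiftXY_map_polyC a : shiftXY a^:P = a^:P%:P.
Proof. by rewrite /shiftXY swapXY_map_polyC map_polyC. Qed.

Lemma shiftXY_eq0 A : (shiftXY A == 0) = (A == 0).
Proof.
rewrite /shiftXY -(swapXY_eq0 A) -!size_poly_eq0 size_map_inj_poly ?rmorph0 //.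
exact: map_inj_poly (@polyC_inj K) (polyC0 K).
Qed.

Lemma lead_coef_shiftXY A : lead_coef (shiftXY A) = (lead_coef (swapXY A))^:P.
Proof.
by rewrite lead_coef_map_inj ?rmorph0 //; apply/map_inj_poly; [exact: polyC_inj|].
Qed.

Lemma lead_coef_map_polyC (R : nzRingType) (q : {poly R}) :
  lead_coef q^:P = (lead_coef q)%:P.
Proof. by rewrite lead_coef_map_inj //; apply: polyC_inj. Qed.

Lemma cocycle_factor A B : A != 0 -> B != 0 ->
    A^:P * B%:P * shiftXY A = shiftXY B * A%:P * B^:P ->
  exists a b C, [/\ A = a%:P * b^:P * C & B = b%:P * a^:P * C].
Proof.
move=> A0 B0 e.
have := congr1 lead_coef e.
rewrite !lead_coefM !lead_coef_map_polyC !lead_coefC !lead_coef_shiftXY.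
(* Leading coefficients in y: a(x), b(x) come from A(x, y), B(x, y), and a'(z), b'(z) from A(y, z),
   B(y, z). Thus [eL] reads a(x) B(x, z) a'(z) = b'(z) A(x, z) b(x). *)
set a := lead_coef A; set a' := lead_coef (swapXY A).
set b := lead_coef B; set b' := lead_coef (swapXY B) => eL.
have a0 : a != 0 by rewrite lead_coef_eq0.
have b0 : b != 0 by rewrite lead_coef_eq0.
have a'0 : a' != 0 by rewrite lead_coef_eq0 swapXY_eq0.
have b'0 : b' != 0 by rewrite lead_coef_eq0 swapXY_eq0.
(* Use [eL] at (x, y), (y, z) and (x, z). In the product of the first two with the third reversed,
   [e] cancels the bivariate factors and those in x or z cancel in pairs, leaving a(y) a'(y) = b(y)
   b'(y). *)
have eab : a * a' = b * b'.
  apply/(map_inj_poly (@polyC_inj K) (polyC0 K)).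
  apply/(map_inj_poly (@polyC_inj {poly K}) (polyC0 _)).
  have := congr1 (map_poly polyC) eL.
  have := congr1 shiftXY eL.
  have := congr1 polyC eL.
  rewrite !(rmorphM, shiftXYM) /= !shiftXY_polyC !shiftXY_map_polyC !map_polyC /=.
  set ax := a%:P%:P; set az' := a'^:P%:P; set bx := b%:P%:P; set bz' := b'^:P%:P.
  set ay := a^:P^:P; set ay' := a'^:P^:P; set by_ := b^:P^:P; set by' := b'^:P^:P.
  move=> e13 e23 e12.
  have nz : ax * az' * bx * bz' * (shiftXY B * A%:P * B^:P) != 0.
    by rewrite !mulf_neq0 ?polyC_eq0 ?map_polyC_eq0 ?shiftXY_eq0.
  apply: (mulIf nz).
  transitivity ((ax * B^:P * ay') * (ay * shiftXY B * az') * (bz' * A%:P * bx)).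
    ring.
  by rewrite e12 e23 -e -e13; ring.
(* With g = gcd(a, b), coprimality of a1 and b1 forces a' = h b1 and b' = h a1; the factor g(u) h(v)
   then drops out of [eL]. *)
have [g [a1 [b1 [ea eb cop g0]]]] : exists g a1 b1,
    [/\ a = a1 * g, b = b1 * g, coprimep a1 b1 & g != 0].
  exists (gcdp a b), (a %/ gcdp a b), (b %/ gcdp a b).
  by rewrite !divpK ?dvdp_gcdl ?dvdp_gcdr ?coprimep_div_gcd ?a0 ?gcdp_eq0 ?negb_and ?a0.
have a10 : a1 != 0 by apply: contra_neq a0 => a10; rewrite ea a10 mul0r.
have b10 : b1 != 0 by apply: contra_neq b0 => b10; rewrite eb b10 mul0r.
have eab1 : a1 * a' = b1 * b'.
  apply: (mulIf g0); transitivity (a * a'); first by rewrite ea; ring.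
  by rewrite eab eb; ring.
have [h ea'] : exists h, a' = h * b1.
  apply/dvdpP; rewrite -(@Gauss_dvdpr _ _ a1) 1?coprimep_sym //.
  by rewrite eab1 dvdp_mulr.
have eb' : b' = h * a1 by apply: (mulfI b10); rewrite -eab1 ea'; ring.
have h0 : h != 0 by apply: contra_neq a'0 => h0; rewrite ea' h0 mul0r.
have eAB : A * b1%:P * a1^:P = B * a1%:P * b1^:P.
  have gh0 : g%:P * h^:P != 0 by rewrite mulf_neq0 ?polyC_eq0 ?map_polyC_eq0.
  move: eL; rewrite ea eb ea' eb' !polyCM !rmorphM /= => eL.
  apply: (mulIf gh0).
  by transitivity (h^:P * a1^:P * A * (b1%:P * g%:P)); [|rewrite -eL]; ring.
have [C eC] := coprime_cross_factor cop a10 b10 eAB.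
exists a1, b1, C; split=> //.
have nz : a1%:P * b1^:P != 0 by rewrite mulf_neq0 ?polyC_eq0 ?map_polyC_eq0.
by apply: (mulIf nz); rewrite mulrA -eAB eC; ring.
Qed.

End Bivariate.

(** * Comparison of coefficients in the braid relation *)

Section Expansion.
Variables (R : comNzRingType) (s s' : {rmorphism R -> R}).
Hypotheses (sK : involutive s) (s'K : involutive s').
Variables (x y z : R).
Hypotheses (sx : s x = y) (sz : s z = z) (s'y : s' y = z) (s'x : s' x = x).

Let M := (x - y) * (y - z) * (x - z).

Lemma braid_expansion (p w : R -> R) (t q t' q' : R) :
    (forall f, (x - y) * p f = t * f - q * s f) ->
    (forall f, (y - z) * w f = t' * f - q' * s' f) ->
  exists c0 c1 c2, forall f, M * M * p (w (p f)) =
    c0 * f + c1 * s f + c2 * s' f + M * (q * s q' * s (s' t)) * s (s' f)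
    + M * (t * q' * s' q) * s' (s f) - M * (q * s q' * s (s' q)) * s (s' (s f)).
Proof.
move=> pE wE.
have sy : s y = x by rewrite -sx sK.
have s'z : s' z = y by rewrite -s'y s'K.
pose X := x - y; pose Y := y - z; pose Z := x - z.
exists (Y * Z ^+ 2 * t ^+ 2 * t' - Y ^+ 2 * Z * q * s q * s t').
exists (Y ^+ 2 * Z * q * s t * s t' - Y * Z ^+ 2 * t * t' * q).
exists (- (M * t * q' * s' t)) => f.
set g := p f; set h := w g.
have Eg : X * g = t * f - q * s f := pE f.
have Eh : Y * h = t' * g - q' * s' g := wE g.
have Ek : X * p h = t * h - q * s h := pE h.
(* The maps s, s' and s s' send X to -X, Z and Y, and s sends Y to Z, so no new denominators
   arise. *)
have Esg : X * s g = s q * f - s t * s f.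
  have := congr1 s Eg; rewrite !(rmorphB, rmorphM) /= sx sy sK => e.
  by rewrite -[X]opprB mulNr e opprB.
have Es'g : Z * s' g = s' t * s' f - s' q * s' (s f).
  by have := congr1 s' Eg; rewrite !(rmorphB, rmorphM) /= s'x s'y.
have Ess'g : Y * s (s' g) = s (s' t) * s (s' f) - s (s' q) * s (s' (s f)).
  by have := congr1 s Es'g; rewrite !(rmorphB, rmorphM) /= sx sz.
have Esh : Z * s h = s t' * s g - s q' * s (s' g).
  by have := congr1 s Eh; rewrite !(rmorphB, rmorphM) /= sy sz.
transitivity (Y * Z * M * (X * p h)); first by rewrite /M -/X -/Y -/Z; ring.
rewrite Ek.
transitivity (t * Z * M * (Y * h) - q * Y * M * (Z * s h)); first by ring.
rewrite Eh Esh.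
transitivity (t * Z * (t' * Y * Z * (X * g) - q' * X * Y * (Z * s' g))
   - q * Y * (s t' * Y * Z * (X * s g) - s q' * X * Z * (Y * s (s' g)))).
  by rewrite /M -/X -/Y -/Z; ring.
rewrite Eg Esg Es'g Ess'g /M -/X -/Y -/Z; ring.
Qed.

End Expansion.

(** The c's are the coefficients of id, s, s', s s', s' s and s s' s, tested on monomials in x and
    y. The last two carry the information on T and Q0. *)
Lemma permutation_coef_eq0 (R : idomainType) (x y z c0 c1 c2 c3 c4 c5 : R) :
    x != y -> y != z -> x != z ->
    (forall i j : nat,
       c0 * (x ^+ i * y ^+ j) + c1 * (y ^+ i * x ^+ j) + c2 * (x ^+ i * z ^+ j)
     + c3 * (y ^+ i * z ^+ j) + c4 * (z ^+ i * x ^+ j) + c5 * (z ^+ i * y ^+ j) = 0) ->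
  c4 = 0 /\ c5 = 0.
Proof.
move=> xy yz xz.
pose e i j := c0 * (x ^+ i * y ^+ j) + c1 * (y ^+ i * x ^+ j)
  + c2 * (x ^+ i * z ^+ j) + c3 * (y ^+ i * z ^+ j)
  + c4 * (z ^+ i * x ^+ j) + c5 * (z ^+ i * y ^+ j).
rewrite -/(forall i j, e i j = 0) => e0.
(* Each term comes from a permutation of x, y, z taking x, y to a, b; weighting
   it by (a - x)(a - y)(b - r) kills all but the last two. *)
have elim r :
    c4 * ((z - x) * (z - y) * (x - r)) + c5 * ((z - x) * (z - y) * (y - r)) = 0.
  transitivity (e 2%N 1%N - (x + y) * e 1%N 1%N + x * y * e 0%N 1%N
    - r * (e 2%N 0%N - (x + y) * e 1%N 0%N + x * y * e 0%N 0%N)).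
    by rewrite /e; ring.
  by rewrite !e0; ring.
have nz u v : u != v -> (z - x) * (z - y) * (u - v) != 0.
  by move=> uv; rewrite !mulf_neq0 // subr_eq0 // eq_sym.
(* Taking r = y isolates c4, and r = x isolates c5. *)
have := elim x; have := elim y; rewrite !subrr !mulr0 addr0 add0r.
have yx : y != x by rewrite eq_sym.
have cancel c u v : u != v -> c * ((z - x) * (z - y) * (u - v)) = 0 -> c = 0.
  by move=> uv /eqP; rewrite mulf_eq0 (negPf (nz _ _ uv)) orbF => /eqP.
by move=> /(cancel _ _ _ xy) -> /(cancel _ _ _ yx) ->.
Qed.

Lemma braid_coef (R : idomainType) (s s' : {rmorphism R -> R}) (x y z : R)
    (p w : R -> R) (t q t' q' : R) :
    involutive s -> involutive s' ->
    (forall f, s (s' (s f)) = s' (s (s' f))) ->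
    s x = y -> s z = z -> s' y = z -> s' x = x ->
    x != y -> y != z -> x != z ->
    (forall f, (x - y) * p f = t * f - q * s f) ->
    (forall f, (y - z) * w f = t' * f - q' * s' f) ->
    (forall f, p (w (p f)) = w (p (w f))) ->
    q != 0 -> q' != 0 ->
  t = s' (s t') /\ q * s q' * s (s' q) = q' * s' q * s' (s q').
Proof.
move=> sK s'K sss sx sz s'y s'x xy yz xz pE wE braid q0 q'0.
have sy : s y = x by rewrite -sx sK.
have s'z : s' z = y by rewrite -s'y s'K.
pose M := (x - y) * (y - z) * (x - z).
have M0 : M != 0 by rewrite !mulf_neq0 // subr_eq0.
have [c0 [c1 [c2 E1]]] := braid_expansion sK s'K sx sz s'y s'x pE wE.
have pE' f : (y - x) * p f = - t * f - - q * s f.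
  by rewrite -opprB mulNr pE; ring.
have wE' f : (z - y) * w f = - t' * f - - q' * s' f.
  by rewrite -opprB mulNr wE; ring.
(* Reversing the order of the variables exchanges the roles of p and w. *)
have [d0 [d1 [d2 E2]]] := braid_expansion s'K sK s'z s'x sy sz wE' pE'.
(* In the second expansion s and s' change places, so d1 belongs to s' and d2 to s, while s s' s =
   s' s s' matches the longest words. *)
have := @permutation_coef_eq0 R x y z (c0 - d0) (c1 - d2) (c2 - d1)
  (M * (q * s q' * s (s' t)) - M * (t' * q * s q'))
  (M * (q' * s' q) * (t - s' (s t')))
  (M * (q' * s' q * s' (s q') - q * s q' * s (s' q))) xy yz xz.
case=> [i j|/eqP + /eqP].
  pose f := x ^+ i * y ^+ j.
  have := E1 f; rewrite braid.
  have := E2 f.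
  have -> : (z - y) * (y - x) * (z - x) = - M by rewrite /M; ring.
  rewrite !rmorphN -sss mulrNN => -> {E1 E2}.
  rewrite /f !(rmorphM, rmorphXn) /= !(sx, sy, sz, s'x, s'y, s'z).
  rewrite -/M => /eqP; rewrite -subr_eq0 => /eqP e.
  by rewrite -[RHS]oppr0 -[in RHS]e; ring.
have N0 : M * (q' * s' q) != 0.
  by rewrite !(mulf_neq0 M0, mulf_neq0 q'0) // -(rmorph0 s') (inj_eq (can_inj s'K)).
rewrite mulf_eq0 (negPf N0) subr_eq0 => /eqP ->.
by rewrite mulf_eq0 (negPf M0) subr_eq0 => /eqP ->.
Qed.

(** * Substitutions, swaps and the numerator of a divided difference operator *)

Lemma mpoly_rmorph_ext (R : nzRingType) (m : nat) (S : nzRingType)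
    (g h : {rmorphism {mpoly R[m]} -> S}) :
  (forall c, g c%:MP = h c%:MP) -> (forall i, g 'X_i = h 'X_i) -> g =1 h.
Proof.
move=> eC eX; elim/mpolyind => [|c e q _ _ IH]; first by rewrite !rmorph0.
rewrite !rmorphD IH -mul_mpolyC !rmorphM /= eC; congr (_ * _ + _).
rewrite mpolyXE_id !rmorph_prod; apply: eq_bigr => i _.
by rewrite !rmorphXn /= eX.
Qed.

Lemma rmorph_subst2 (K : fieldType) (n m : nat)
    (g : {rmorphism {mpoly K[n]} -> {mpoly K[m]}}) (A : {mpoly K[2]})
    (a b : {mpoly K[n]}) :
  (forall c, g c%:MP = c%:MP) -> g (subst2 A a b) = subst2 A (g a) (g b).
Proof.
move=> gC; rewrite /subst2.
apply: (mpoly_rmorph_ext (g := g \o comp_mpoly [tuple a; b])).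
  by move=> c /=; rewrite !comp_mpolyC.
by move=> i /=; rewrite !comp_mpolyXU; case: i => [[|[]]].
Qed.

Section DividedDifferenceOperators.
Variables (K : fieldType) (n : nat).
Implicit Types (i j k : 'I_n) (A : {mpoly K[2]}).

Lemma swap_subst2 i j A (a b : {mpoly K[n]}) :
  swap i j (subst2 A a b) = subst2 A (swap i j a) (swap i j b).
Proof.
by apply: (rmorph_subst2 (g := msym (tperm i j))) => c; rewrite /= /msym mmapC.
Qed.

Lemma swapK i j : involutive (@swap K n i j).
Proof. by move=> f; rewrite /swap -msymMm tperm2 msym1m. Qed.

Lemma swapL i j : @swap K n i j 'X_i = 'X_j.
Proof. by rewrite swapX tpermL. Qed.

Lemma swapR i j : @swap K n i j 'X_j = 'X_i.
Proof. by rewrite swapX tpermR. Qed.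

Lemma swapD i j k : i != k -> j != k -> @swap K n i j 'X_k = 'X_k.
Proof. by move=> ik jk; rewrite swapX tpermD. Qed.

(** Both sides are the transposition (i k), as the conjugate of (j k) by (i j) and of (i j) by (j
    k). *)
Lemma swap_braid i j k f : i != j -> j != k -> i != k ->
  @swap K n i j (swap j k (swap i j f)) = swap j k (swap i j (swap j k f)).
Proof.
move=> ij jk ik; rewrite /swap -!msymMm; congr msym.
have := tpermJ j k (tperm i j); have := tpermJ i j (tperm j k).
rewrite /conjg !tpermV tpermR tpermL !mulgA => ->.
by rewrite !tpermD // eq_sym.
Qed.

Lemma subst2_inj i j :
  i != j -> injective (fun A => subst2 A ('X_i : {mpoly K[n]}) 'X_j).
Proof.
(* A left inverse: X_i goes back to u and every other variable, in particular X_j, to v. *)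
move=> ij; pose T := [tuple if k == i then var_u K else var_v K | k < n].
apply: (can_inj (g := comp_mpoly T)) => A.
rewrite (rmorph_subst2 (g := comp_mpoly T)) /=; last by move=> c; exact: comp_mpolyC.
rewrite !comp_mpolyXU -!tnth_nth !tnth_mktuple eqxx eq_sym (negPf ij).
rewrite /subst2 -[RHS]comp_mpoly_id; congr comp_mpoly.
apply: eq_from_tnth => -[[|[]]] // k; rewrite tnth_mktuple;
  by congr 'X_ _; apply: val_inj.
Qed.

(** Since s(P f) = s(P) s(f), clearing the denominator gives s f the coefficient -P(y, x) - Q + (x -
    y) S; hence the exchanged variables of P in Q0. *)
Lemma pdd_actE i j (w : pdd K) f :
  ('X_i - 'X_j) * pdd_act i j w f =
  subst2 (pdd_T w) 'X_i 'X_j * f - subst2 (pdd_Q0 w) 'X_i 'X_j * swap i j f.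
Proof.
rewrite /pdd_act /pdd_T /pdd_Q0.
have sD A B (a b : {mpoly K[n]}) : subst2 (A + B) a b = subst2 A a b + subst2 B a b.
  exact: comp_mpolyD.
have sN A (a b : {mpoly K[n]}) : subst2 (- A) a b = - subst2 A a b by exact: comp_mpolyN.
have sM A B (a b : {mpoly K[n]}) : subst2 (A * B) a b = subst2 A a b * subst2 B a b.
  exact: rmorphM.
have sX (a b : {mpoly K[n]}) : (subst2 (var_u K) a b = a) * (subst2 (var_v K) a b = b).
  by rewrite /subst2 !comp_mpolyXU.
have sS A :
    subst2 (subst2 A (var_v K) (var_u K)) 'X_i 'X_j = swap i j (subst2 A 'X_i 'X_j).
  rewrite swap_subst2 swapL swapR /subst2.
  rewrite -[LHS]/(comp_mpoly [tuple 'X_i; 'X_j] (subst2 A _ _)).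
  rewrite (rmorph_subst2 (g := comp_mpoly [tuple 'X_i; 'X_j])) /=.
    by rewrite !comp_mpolyXU.
  by move=> c; apply: comp_mpolyC.
rewrite !(sD, sN, sM) !sX sS.
set P := subst2 (pdd_P w) _ _; set Q := subst2 (pdd_Q w) _ _.
have := divdiffP i j (P * f); have := divdiffP i j f.
have -> : swap i j (P * f) = swap i j P * swap i j f by apply: rmorphM.
move=> e1 e2.
rewrite !mulrDr -e2 (mulrCA _ Q) -e1; ring.
Qed.

Lemma mpolyX_neq i j : i != j -> ('X_i : {mpoly K[n]}) != 'X_j.
Proof.
move=> ij; apply: contraTneq isT => /(congr1 (mcoeff U_(i))).
by rewrite !mcoeffXU eqxx eq_sym (negPf ij) => /eqP; rewrite oner_eq0.
Qed.

Lemma pdd_braid_coef (x y z : 'I_n) (p w : pdd K) : uniq [:: x; y; z] ->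
    (forall f : {mpoly K[n]},
       pdd_act x y p (pdd_act y z w (pdd_act x y p f)) =
       pdd_act y z w (pdd_act x y p (pdd_act y z w f))) ->
    pdd_Q0 p != 0 -> pdd_Q0 w != 0 ->
  let X := 'X_x : {mpoly K[n]} in let Y := 'X_y in let Z := 'X_z in
  pdd_T p = pdd_T w /\
  subst2 (pdd_Q0 p) X Y * subst2 (pdd_Q0 w) X Z * subst2 (pdd_Q0 p) Y Z =
  subst2 (pdd_Q0 w) Y Z * subst2 (pdd_Q0 p) X Z * subst2 (pdd_Q0 w) X Y.
Proof.
rewrite /= !inE !andbT negb_or => /andP [/andP [xy xz] yz] braid Qp Qw.
have neq i j : i != j -> 'X_i != 'X_j :> {mpoly K[n]} by apply: mpolyX_neq.
have Q0 i j A : i != j -> A != 0 -> subst2 A ('X_i : {mpoly K[n]}) 'X_j != 0.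
  move=> ij; apply: contra_neq => A0; apply: (subst2_inj ij).
  by rewrite /= A0 /subst2 comp_mpoly0.
have sss (f : {mpoly K[n]}) :
    swap x y (swap y z (swap x y f)) = swap y z (swap x y (swap y z f)).
  exact: swap_braid.
have sE i j A k l : msym (tperm i j) (subst2 A ('X_k : {mpoly K[n]}) 'X_l) =
    subst2 A 'X_(tperm i j k) 'X_(tperm i j l).
  by rewrite -[LHS]/(swap i j _) swap_subst2 !swapX.
have yx : y != x by rewrite eq_sym.
have zx : z != x by rewrite eq_sym.
have [] := @braid_coef _ (msym (tperm x y)) (msym (tperm y z)) 'X_x 'X_y 'X_z
  _ _ _ _ _ _ (@swapK x y) (@swapK y z) sss (swapL x y) (swapD xz yz)
  (swapL y z) (swapD yx zx) (neq _ _ xy) (neq _ _ yz) (neq _ _ xz)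
  (pdd_actE x y p) (pdd_actE y z w) braid (Q0 _ _ _ xy Qp) (Q0 _ _ _ yz Qw).
have tz : tperm x y z = z by rewrite tpermD.
have tx : tperm y z x = x by rewrite tpermD.
(* The swap of x and y takes (y, z) to (x, z), and that of y and z takes (x, z) to (x, y): both T's
   end up in the same variables. *)
rewrite /= !sE !(tpermL, tpermR, tz, tx) => eT eQ; split=> //.
exact: (subst2_inj xy eT).

Qed.

End DividedDifferenceOperators.

(** * Passage between [{mpoly K[2]}] and K[u][v] *)

Section Transport.
Variable K : fieldType.
Implicit Types A B : {mpoly K[2]}.

Definition bipoly : {rmorphism {mpoly K[2]} -> {poly {poly K}}} :=
  mmap (polyC \o polyC) (fun i : 'I_2 => if i == 0 then 'Y else 'X).

Let u_comm : commr_rmorph (@mpolyC 2 K) (var_u K) := fun c => mulrC _ _.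

Definition subst1u : {rmorphism {poly K} -> {mpoly K[2]}} := horner_morph u_comm.

Let v_comm : commr_rmorph subst1u (var_v K) := fun c => mulrC _ _.

Definition of_bipoly : {rmorphism {poly {poly K}} -> {mpoly K[2]}} :=
  horner_morph v_comm.

Lemma subst1uE a : subst1u a = subst1 a (var_u K).
Proof. by []. Qed.

Lemma of_bipolyE (U : {poly {poly K}}) :
  of_bipoly U = (map_poly subst1u U).[var_v K].
Proof. by []. Qed.

Lemma bipolyC c : bipoly c%:MP = c%:P%:P.
Proof. exact: mmapC. Qed.

Lemma bipolyX i : bipoly 'X_i = if i == 0 then 'Y else 'X.
Proof. by rewrite /bipoly /= mmapX mmap1U. Qed.

Lemma of_bipoly_polyC a : of_bipoly a%:P = subst1 a (var_u K).
Proof. by rewrite of_bipolyE map_polyC hornerC. Qed.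

Lemma of_bipoly_map_polyC a : of_bipoly a^:P = subst1 a (var_v K).
Proof.
rewrite of_bipolyE -map_poly_comp; congr horner.
by apply: eq_map_poly => c /=; rewrite subst1uE /subst1 map_polyC hornerC.
Qed.

Lemma bipolyK : cancel bipoly of_bipoly.
Proof.
apply: (mpoly_rmorph_ext (g := of_bipoly \o bipoly) (h := idfun)) => [c|i].
  by rewrite /= bipolyC of_bipoly_polyC /subst1 map_polyC hornerC.
rewrite [LHS]/= bipolyX; case: i => [[|[]]] // k.
  by rewrite of_bipoly_polyC /subst1 map_polyX hornerX; congr 'X_ _; apply: val_inj.
by rewrite of_bipolyE map_polyX hornerX; congr 'X_ _; apply: val_inj.
Qed.

Lemma cocycle_almost_equal n (x y z : 'I_n) A B : uniq [:: x; y; z] ->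
    let X := 'X_x : {mpoly K[n]} in let Y := 'X_y in let Z := 'X_z in
    A != 0 -> B != 0 ->
    subst2 A X Y * subst2 B X Z * subst2 A Y Z =
    subst2 B Y Z * subst2 A X Z * subst2 B X Y ->
  almost_equal A B.
Proof.
rewrite /= !inE !andbT negb_or => /andP [/andP [xy xz] yz] A0 B0 e.
split=> //.
(* Every variable other than x and y goes to ['Y], the intended image of z; the identity involves no
   further variable. *)
pose h (i : 'I_n) : {poly {poly {poly K}}} :=
  if i == x then 'Y%:P else if i == y then 'X else 'Y.
pose g : {rmorphism {mpoly K[n]} -> {poly {poly {poly K}}}} :=
  mmap (polyC \o (polyC \o polyC)) h.
have hx : h x = 'Y%:P by rewrite /h eqxx.
have hy : h y = 'X by rewrite /h eq_sym (negPf xy) eqxx.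
have hz : h z = 'Y by rewrite /h eq_sym (negPf xz) eq_sym (negPf yz).
have gX i : g 'X_i = h i by rewrite /g /= mmapX mmap1U.
have gC c : g c%:MP = c%:P%:P%:P by rewrite /g /= mmapC.
have ext (k : {rmorphism {mpoly K[2]} -> {poly {poly {poly K}}}}) (a b : 'I_n) :
    (forall c, k c%:MP = c%:P%:P%:P) -> k 'X_0 = h a -> k 'X_1 = h b ->
    forall C, g (subst2 C 'X_a 'X_b) = k C.
  move=> kC k0 k1.
  apply: (mpoly_rmorph_ext (g := g \o comp_mpoly [tuple 'X_a; 'X_b])) => [c|i] /=.
    by rewrite comp_mpolyC gC kC.
  rewrite comp_mpolyXU; case: i => [[|[]]] // i; rewrite gX -?k0 -?k1.
    by congr (k 'X_ _); apply: val_inj.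
  by congr (k 'X_ _); apply: val_inj.
have gXY C : g (subst2 C 'X_x 'X_y) = (bipoly C)^:P.
  apply: (ext (map_poly polyC \o bipoly)) => [c||] /=.
  - by rewrite bipolyC !map_polyC.
  - by rewrite bipolyX map_polyC.
  - by rewrite bipolyX map_polyX.
have gXZ C : g (subst2 C 'X_x 'X_z) = (bipoly C)%:P.
  apply: (ext (polyC \o bipoly)) => [c||] /=.
  - by rewrite bipolyC.
  - by rewrite bipolyX.
  - by rewrite bipolyX.
have gYZ C : g (subst2 C 'X_y 'X_z) = shiftXY (bipoly C).
  apply: (ext (map_poly (map_poly polyC) \o (@swapXY K \o bipoly))) => [c||] /=.
  - by rewrite bipolyC swapXY_polyC !map_polyC /= map_polyC.
  - by rewrite bipolyX swapXY_Y map_polyX.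
  - by rewrite bipolyX swapXY_X map_polyC /= map_polyX.
have bi0 C : C != 0 -> bipoly C != 0.
  by apply: contra_neq => C0; rewrite -[C]bipolyK C0 rmorph0.
have := congr1 g e; rewrite !rmorphM /= !gXY !gXZ !gYZ.
move/(cocycle_factor (bi0 _ A0) (bi0 _ B0)) => [a [b [C [eA eB]]]].
(* The second pair of univariate factors is the first one exchanged, so the condition on their
   products is a b = b a. *)
exists (of_bipoly C), a, b, b, a; split; first exact: mulrC.
  by rewrite -[A in LHS]bipolyK eA !rmorphM /= of_bipoly_polyC of_bipoly_map_polyC.
by rewrite -[B in LHS]bipolyK eB !rmorphM /= of_bipoly_polyC of_bipoly_map_polyC.
Qed.

End Transport.

Theorem lemma11 (K : fieldType) (n : nat) (x y z : 'I_n)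
    (hxyz : uniq [:: x; y; z]) (p w : pdd K)
    (p_neq0 : exists f : {mpoly K[n]}, pdd_act x y p f != 0)
    (w_neq0 : exists f : {mpoly K[n]}, pdd_act y z w f != 0)
    (braid : forall f : {mpoly K[n]},
       pdd_act x y p (pdd_act y z w (pdd_act x y p f)) =
       pdd_act y z w (pdd_act x y p (pdd_act y z w f)))
    (Q0p_neq0 : pdd_Q0 p != 0) (Q0w_neq0 : pdd_Q0 w != 0) :
  pdd_T p = pdd_T w /\ almost_equal (pdd_Q0 p) (pdd_Q0 w).
Proof.
have [eT eQ] := pdd_braid_coef hxyz braid Q0p_neq0 Q0w_neq0.
by split=> //; apply: cocycle_almost_equal hxyz Q0p_neq0 Q0w_neq0 eQ.
Qed.
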